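(* Let $G$ be a connected bipartite cubic graph of order $n$. Then $G$ has an IPD and $\rho(G) \le \frac{n}{3}$.
   Context: All graphs are finite and simple; cubic means $3$-regular. The order of a path is its number of vertices. A path $P$ in $G$ is induced if the subgraph of $G$ induced on $V(P)$ is exactly $P$. An IPD of $G$ is a partition of $V(G)$ into sets $V_1,\dots,V_t$ such that each $G[V_i]$ is a path of order at least $2$; its size is $t$. $\rho(G)$ denotes the smallest size of an IPD of $G$. *)

(* Defs.v *)
From mathcomp Require Import all_boot.
Set Implicit Arguments.
Unset Strict Implicit.
Unset Printing Implicit Defensive.

Definition simple_graph (T : finType) (e : rel T) : Prop :=
  symmetric e /\ irreflexive e.

Definition cubic (T : finType) (e : rel T) : Prop :=
  forall x : T, #|[set y | e x y]| = 3.

Definition connected (T : finType) (e : rel T) : Prop :=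
  forall x y : T, connect e x y.

Definition bipartite (T : finType) (e : rel T) : Prop :=
  exists c : T -> bool, forall x y, e x y -> c x != c y.

Definition induced_path (T : finType) (e : rel T) (S : {set T}) : Prop :=
  exists s : seq T,
    [/\ uniq s, 2 <= size s, S = [set x in s] &
      forall (x0 : T) (i j : nat), i < size s -> j < size s ->
        e (nth x0 s i) (nth x0 s j) = (j == i.+1) || (i == j.+1)].

Definition IPD (T : finType) (e : rel T) (P : {set {set T}}) : Prop :=
  partition P [set: T] /\ forall S, S \in P -> induced_path e S.

(* Main.v *)
(** Every part of the partition is a path on three vertices or an induced path
on four, which gives the bound at once.  Such a partition is read off a
2-factor without 4-cycles.  A cycle of length l (even, l >= 6) is cut into
consecutive paths of order 3, with one path of order 4 if l = 1 mod 3 and two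
if l = 2 mod 3; a segment of order 4 is induced unless its ends are joined by
a chord, and each vertex has only one chord, so suitable cuts exist.

The 2-factor is the complement of a perfect matching that meets every 4-cycle.
Take a maximal family F of disjoint 4-cycles and contract in each of them the
two vertices of equal colour.  The resulting multigraph is again bipartite and
cubic, so it has a perfect matching, which lifts to one that meets every
4-cycle of F.  If a 4-cycle S is still missed, it shares an edge with a
4-cycle Q of F, and the two edges of Q next to the shared one lie in the
matching; exchanging the two perfect matchings of Q hits S without losing any
other 4-cycle. *)

Require Import Defs.
From mathcomp Require Import all_boot zify.
Set Implicit Arguments.
Unset Strict Implicit.
Unset Printing Implicit Defensive.

(** * Hall's theorem and perfect matchings of regular bipartite multigraphs *)

Lemma hall (X Y : finType) (y0 : Y) (R : X -> {set Y}) (A : {set X}) :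
  (forall S : {set X}, S \subset A -> #|S| <= #|\bigcup_(x in S) R x|) ->
  exists f : X -> Y,
    {in A &, injective f} /\ (forall x, x \in A -> f x \in R x).
Proof.
have [n] := ubnP #|A|; elim: n R A => // n IHn R A /ltnSE leAn hallA.
(* The Halmos-Vaughan dichotomy. If a proper nonempty [S] is tight, [S] and [A :\: S] are matched
   separately, the latter outside the neighbourhood of [S]. Otherwise there is slack everywhere and
   any single pair may be removed. *)
have [[S [SA S0 SnA tight]] | loose] :
  (exists S : {set X}, [/\ S \subset A, S != set0, S != A &
     #|\bigcup_(x in S) R x| <= #|S|]) \/
  (forall S : {set X}, S \subset A -> S != set0 -> S != A ->
     #|S| < #|\bigcup_(x in S) R x|).
- have [/existsP[S /and4P[? ? ? ?]]|/existsPn no] := boolP [exists S : {set X},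
    [&& S \subset A, S != set0, S != A & #|\bigcup_(x in S) R x| <= #|S|]].
    by left; exists S.
  by right=> S SA S0 SnA; move: (no S); rewrite SA S0 SnA /= -ltnNge.
- have SpA : S \proper A by rewrite properEneq SnA.
  have [f [f_inj fR]] : exists f : X -> Y,
      {in S &, injective f} /\ (forall x, x \in S -> f x \in R x).
    apply: IHn => [|U US]; first exact: leq_trans (proper_card SpA) leAn.
    exact/hallA/(subset_trans US).
  pose NS := \bigcup_(x in S) R x.
  have [g [g_inj gR]] : exists g : X -> Y, {in A :\: S &, injective g} /\
      (forall x, x \in A :\: S -> g x \in R x :\: NS).
    apply: IHn => [|U US].
      have := cardsID S A; rewrite (setIidPr SA).
      by rewrite -card_gt0 in S0; lia.
    have disUS : [disjoint U & S].
      by rewrite disjoint_subset; apply: subset_trans US _;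
         apply/subsetP=> x; rewrite !inE => /andP[].
    have UA : U :|: S \subset A.
      by rewrite subUset SA andbT (subset_trans US) // subsetDl.
    (* Hall's condition for [U :|: S], less the tight part [S], is Hall's condition for [U] outside
       [NS]. *)
    have := hallA _ UA; rewrite cardsU (disjoint_setI0 disUS) cards0 subn0.
    rewrite bigcup_setU -/NS.
    have -> : \bigcup_(x in U) (R x :\: NS) = (\bigcup_(x in U) R x) :\: NS.
      apply/setP=> y; rewrite in_setD; apply/bigcupP/andP.
        by case=> x xU; rewrite in_setD => /andP[? ?]; split=> //;
           apply/bigcupP; exists x.
      by case=> yN /bigcupP[x xU yR]; exists x => //; rewrite in_setD yN.
    have := cardsID NS ((\bigcup_(x in U) R x) :|: NS).
    rewrite setDUl setDv setU0 setIUl setIid.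
    have := subset_leq_card (subsetUr ((\bigcup_(x in U) R x) :&: NS) NS).
    have := subset_leq_card (subsetIr (\bigcup_(x in U) R x) NS).
    have -> : (\bigcup_(x in U) R x) :&: NS :|: NS = NS.
      by apply/setUidPr; apply: subsetIr.
    by rewrite -/NS in tight; lia.
  exists (fun x => if x \in S then f x else g x); split=> [x y xA yA|x xA].
    have fN z : z \in S -> f z \in NS.
      by move=> zS; apply/bigcupP; exists z => //; apply: fR.
    have gN z : z \in A -> z \notin S -> g z \notin NS.
      move=> zA zS; have := gR z; rewrite in_setD zS zA => /(_ isT).
      by rewrite in_setD => /andP[].
    case: ifP => xS; case: ifP => yS.
    - exact: f_inj.
    - by move=> Efg; have := gN y yA (negbT yS); rewrite -Efg fN.
    - by move=> Efg; have := gN x xA (negbT xS); rewrite Efg fN.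
    - by apply: g_inj; rewrite in_setD ?xS ?yS.
  case: ifP => xS; first exact: fR.
  by have := gR x; rewrite in_setD xS xA => /(_ isT); rewrite in_setD => /andP[].
- have [->|[x xA]] := set_0Vmem A.
    by exists (fun=> y0); split=> [x y|x]; rewrite inE.
  have [y yR] : exists y, y \in R x.
    have := hallA [set x]; rewrite sub1set xA big_set1 cards1 => /(_ isT).
    by rewrite card_gt0 => /set0Pn.
  have [f [f_inj fR]] : exists f : X -> Y, {in A :\ x &, injective f} /\
      (forall z, z \in A :\ x -> f z \in R z :\ y).
    apply: IHn => [|U US]; first by rewrite (cardsD1 x) xA in leAn.
    have [->|U0] := eqVneq U set0; first by rewrite cards0.
    have UA : U \subset A by apply: subset_trans US _; apply: subsetDl.
    have UnA : U != A.
      by apply: contraTneq xA => <-; apply/negP=> /(subsetP US); rewrite !inE eqxx.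
    have := loose U UA U0 UnA.
    have -> : \bigcup_(z in U) (R z :\ y) = (\bigcup_(z in U) R z) :\ y.
      apply/setP=> w; rewrite in_setD; apply/bigcupP/andP.
        by case=> z zU; rewrite in_setD => /andP[? ?]; split=> //;
           apply/bigcupP; exists z.
      by case=> wN /bigcupP[z zU wR]; exists z => //; rewrite in_setD wN.
    by rewrite (cardsD1 y (\bigcup_(z in U) R z)); case: (y \in _) => /=; lia.
  have fy z : z \in A -> z != x -> (f z != y) && (f z \in R z).
    by move=> zA zx; have := fR z; rewrite !inE zx zA => /(_ isT).
  exists (fun z => if z == x then y else f z); split=> [z w zA wA|z zA].
    case: eqVneq => zx; case: eqVneq => wx.
    - by rewrite zx wx.
    - by move=> Ey; case/andP: (fy w wA wx); rewrite -Ey eqxx.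
    - by move=> Ey; case/andP: (fy z zA zx); rewrite Ey eqxx.
    - by apply: f_inj; rewrite !inE ?zx ?wx.
  by case: eqVneq => [->//|zx]; case/andP: (fy z zA zx).
Qed.

Lemma card_fibers (E X : finType) (D : {set E}) (l : E -> X) k (S : {set X}) :
  (forall d, d \in D -> #|[set d' in D | l d' == l d]| = k) ->
  S \subset l @: D -> #|[set d in D | l d \in S]| = #|S| * k.
Proof.
move=> Dk SD; rewrite -sum1_card.
rewrite (partition_big l (mem S)) => [|d]; last by rewrite !inE => /andP[].
rewrite -sum_nat_const; apply: eq_bigr => x xS.
have /imsetP[d dD xE] := subsetP SD x xS.
rewrite -(Dk d dD) -sum1_card -xE; apply: eq_bigl => d'; rewrite !inE.
by case: eqP => [->|_]; rewrite ?andbF // (xS : x \in S) !andbT.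
Qed.

(** The elements of [D] are the edges of a bipartite multigraph and [l], [r] give their ends; naming
    edges separately allows the parallel ones that a contraction creates. Hall's condition is a
    double count: the [k * #|S|] edges at [S] all end in the neighbourhood of [S], which receives
    [k] edges per vertex. *)
Lemma regular_matching (E X : finType) (D : {set E}) (l r : E -> X) k :
  0 < k ->
  (forall d, d \in D -> #|[set d' in D | l d' == l d]| = k) ->
  (forall d, d \in D -> #|[set d' in D | r d' == r d]| = k) ->
  exists N : {set E}, [/\ N \subset D, {in N &, injective l},
    {in N &, injective r}, l @: D \subset l @: N & r @: D \subset r @: N].
Proof.
move=> k0 Dl Dr; have [->|[d0 d0D]] := set_0Vmem D.
  by exists set0; split; rewrite ?imset0 ?sub0set // => x; rewrite inE.
(* Both sides have [#|D|] divided by [k] vertices, so the injection given by Hall's theorem is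
   onto. *)
have card_im : #|l @: D| = #|r @: D|.
  apply/eqP; rewrite -(eqn_pmul2r k0); apply/eqP.
  rewrite -(card_fibers Dl) // -(card_fibers Dr) //.
  by apply: eq_card => d; rewrite !inE; case dD: (d \in D); rewrite //= !imset_f.
pose R x := r @: [set d in D | l d == x].
have [S SD|f [f_inj fR]] := @hall _ _ (l d0) R (l @: D).
  rewrite -(leq_pmul2r k0).
  have RD : \bigcup_(x in S) R x \subset r @: D.
    by apply/bigcupsP=> x xS; apply/imsetS/subsetP=> d; rewrite inE => /andP[].
  rewrite -(card_fibers Dl SD) -(card_fibers Dr RD); apply/subset_leq_card/subsetP=> d.
  rewrite !inE => /andP[dD dS]; rewrite dD; apply/bigcupP; exists (l d) => //.
  by apply: imset_f; rewrite inE dD eqxx.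
(* Among the possibly parallel edges from [x] to [f x], one is chosen; [d0] is only a default. *)
pose g x := odflt d0 [pick d in D | (l d == x) && (r d == f x)].
have gP x : x \in l @: D -> [/\ g x \in D, l (g x) = x & r (g x) = f x].
  move=> xD; rewrite /g; case: pickP => [d /and3P[? /eqP ? /eqP ?] //|no].
  have /imsetP[d] := fR x xD; rewrite inE => /andP[dD ld] fx.
  by have := no d; rewrite dD ld fx eqxx.
exists (g @: (l @: D)); split.
- by apply/subsetP=> _ /imsetP[x /gP[? _ _] ->].
- by move=> _ _ /imsetP[x /gP[_ lx _] ->] /imsetP[y /gP[_ ly _] ->]; rewrite lx ly => ->.
- move=> _ _ /imsetP[x xD ->] /imsetP[y yD ->].
  have [_ _ ->] := gP x xD; have [_ _ ->] := gP y yD.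
  by move/f_inj => ->.
- by apply/subsetP=> x xD; apply/imsetP; exists (g x); [apply: imset_f | case: (gP x xD)].
- have sub : r @: (g @: (l @: D)) \subset r @: D.
    by apply: imsetS; apply/subsetP=> _ /imsetP[x /gP[? _ _] ->].
  suff -> : r @: D = r @: (g @: (l @: D)) by [].
  apply/esym/eqP; rewrite eqEcard sub -card_im -imset_comp /=.
  rewrite (@card_in_imset _ _ (r \o g)) // => x y xD yD /=.
  by have [_ _ ->] := gP x xD; have [_ _ ->] := gP y yD; apply: f_inj.
Qed.

Lemma card_rel (T : finType) (P : pred T) (R : rel T) :
  #|[set d : T * T | P d.1 & R d.1 d.2]| = \sum_(u | P u) #|[set v | R u v]|.
Proof.
rewrite -sum1_card (eq_bigl (fun d : T * T => P d.1 && R d.1 d.2)); last first.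
  by move=> d; rewrite inE.
rewrite -(pair_big_dep P R (fun _ _ => 1)) /=.
by apply: eq_bigr => u _; rewrite -sum1_card; apply: eq_bigl => v; rewrite inE.
Qed.

(** The multigraph in question has the fibres of [h] as vertices and the edges of [R] as edges. It
    inherits the colouring from [c], and a fibre has as degree the sum of the degrees of its
    members. The matching is kept as a relation on [T], so that one sees which member of each fibre
    it uses. *)
Lemma quotient_matching (T : finType) (R : rel T) (c : T -> bool)
    (h : T -> T) k :
  0 < k -> symmetric R -> (forall x y, R x y -> c x != c y) ->
  (forall x, c (h x) = c x) ->
  (forall x, \sum_(u | h u == h x) #|[set v | R u v]| = k) ->
  exists N : rel T, [/\ symmetric N, subrel N R,
    forall x y x' y', N x y -> N x' y' -> h x = h x' -> x = x' /\ y = y' &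
    forall x, exists x' y, h x' = h x /\ N x' y].
Proof.
move=> k0 symR bipR hc deg.
pose D b := [set d : T * T | (c d.1 == b) && R d.1 d.2].
have Dl b d : d \in D b -> #|[set d' in D b | h d'.1 == h d.1]| = k.
  rewrite inE => /andP[/eqP cd _]; rewrite -(deg d.1) -card_rel.
  apply: eq_card => d'; rewrite !inE.
  case: (h d'.1 =P h d.1) => hd; rewrite ?andbF // andbT.
  by rewrite -(hc d'.1) hd hc cd eqxx.
(* Reversing the edges turns right ends in [D true] into left ends in [D false]. *)
have Dr d : d \in D true -> #|[set d' in D true | h d'.2 == h d.2]| = k.
  move=> dD; rewrite -(Dl false (d.2, d.1)).
    have swap_inj : injective (fun d : T * T => (d.2, d.1)) by case=> ? ? [? ?] [-> ->].
    rewrite -(card_imset _ swap_inj); apply: eq_card => d'.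
    apply/imsetP/idP=> [[d2]|].
      rewrite !inE => /andP[/andP[/eqP c1 Rd] hd] -> /=.
      by rewrite symR Rd hd; have := bipR _ _ Rd; rewrite c1; case: (c _).
    rewrite !inE => /= /andP[/andP[/eqP c1 Rd] hd]; exists (d'.2, d'.1).
      rewrite !inE /= symR Rd hd; have := bipR _ _ Rd.
      by rewrite c1; case: (c _).
    by case: d' {c1 Rd hd}.
  move: dD; rewrite !inE /= => /andP[/eqP c1 Rd]; rewrite symR Rd.
  by have := bipR _ _ Rd; rewrite c1; case: (c _).
have [N [ND injl injr surl surr]] := regular_matching k0 (Dl true) Dr.
have N_D x y : (x, y) \in N -> c x /\ R x y.
  by move/(subsetP ND); rewrite inE => /andP[/eqP].
exists (fun x y => ((x, y) \in N) || ((y, x) \in N)); split.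
- by move=> x y; rewrite orbC.
- by move=> x y /orP[/N_D[]|/N_D[_]] //; rewrite symR.
- move=> x y x' y' N1 N2 hx.
  have cE : c x = c x' by rewrite -hc hx hc.
  case/orP: N1 => N1; case/orP: N2 => N2.
  + by case: (injl _ _ N1 N2 hx).
  + have [cx _] := N_D _ _ N1; have [cy' /bipR] := N_D _ _ N2.
    by rewrite cy' -cE cx.
  + have [cx' _] := N_D _ _ N2; have [cy /bipR] := N_D _ _ N1.
    by rewrite cy cE cx'.
  + by case: (injr _ _ N1 N2 hx).
- move=> x; have [u [hu [v Ruv]]] : exists u, h u = h x /\ exists v, R u v.
    have : 0 < \sum_(u | h u == h x) #|[set v | R u v]| by rewrite deg.
    rewrite lt0n sum_nat_eq0 => /forallPn[u]; rewrite negb_imply => /andP[/eqP hu].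
    by rewrite cards_eq0 => /set0Pn[v]; rewrite inE => Ruv; exists u; split=> //; exists v.
  have := bipR _ _ Ruv; case cu: (c u); case cv: (c v) => // _.
  + have : h u \in [set h d.1 | d in D true].
      by apply/imsetP; exists (u, v); rewrite ?inE //= cu Ruv.
    case/(subsetP surl)/imsetP=> [[u' v'] N' /= hE].
    by exists u', v'; rewrite N' -hE.
  + have : h u \in [set h d.2 | d in D true].
      by apply/imsetP; exists (v, u); rewrite ?inE //= cv symR Ruv.
    case/(subsetP surr)/imsetP=> [[v' u'] N' /= hE].
    by exists u', v'; rewrite N' -hE orbT.
Qed.

Lemma rel_matching (T : finType) (N : rel T) :
  symmetric N -> (forall x y y', N x y -> N x y' -> y = y') ->
  (forall x, exists y, N x y) ->
  exists m : T -> T, involutive m /\ forall x, N x (m x).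
Proof.
move=> symN funN totN; pose m x := odflt x [pick y | N x y].
have mP x : N x (m x).
  by rewrite /m; case: pickP => //= no; have [y] := totN x; rewrite no.
by exists m; split=> // x; apply: (funN (m x)); rewrite // symN.
Qed.

Lemma regular_perfect_matching (T : finType) (R : rel T) (c : T -> bool) k :
  0 < k -> symmetric R -> (forall x y, R x y -> c x != c y) ->
  (forall x, #|[set v | R x v]| = k) ->
  exists m : T -> T, involutive m /\ forall x, R x (m x).
Proof.
move=> k0 symR bipR deg.
have [x|N [symN NR injN totN]] := @quotient_matching T R c id k k0 symR bipR (fun=> erefl).
  by rewrite big_pred1_eq.
have [x y y' N1 N2|x|m [mK mN]] := @rel_matching T N symN.
- by case: (injN _ _ _ _ N1 N2 erefl).
- by have [_ [y [-> ?]]] := totN x; exists y.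
- by exists m; split=> // x; apply: NR.
Qed.

(** * Squares (4-cycles) in a cubic bipartite graph, and matchings that miss them *)

Section CubicBipartite.

Variables (T : finType) (e : rel T) (c : T -> bool).
Hypotheses (sym_e : symmetric e) (cubic_e : cubic e).
Hypothesis bip_e : forall x y, e x y -> c x != c y.

Lemma third_neighbour x y1 y2 : e x y1 -> e x y2 -> y1 != y2 ->
  exists y3, [/\ y3 != y1, y3 != y2 & forall z, e x z = (z \in [:: y1; y2; y3])].
Proof.
move=> e1 e2 n12.
have := cardsD1 y1 [set y | e x y]; rewrite cubic_e inE e1.
rewrite (cardsD1 y2 ([set y | e x y] :\ y1)) !inE e2 eq_sym n12 /=.
case=> /esym/eqP/cards1P[y3 /setP E]; exists y3.
have := E y3; rewrite !inE eqxx => /and3P[n3 n4 e3]; split=> // z.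
have := E z; rewrite !inE; case: (eqVneq z y1) => [->|] /=; first by rewrite e1.
by case: (eqVneq z y2) => [->|] /=; first by rewrite e2.
Qed.

Lemma neighbours3 x y1 y2 y3 z : e x y1 -> e x y2 -> e x y3 ->
  y1 != y2 -> y3 != y1 -> y3 != y2 -> e x z -> [|| z == y1, z == y2 | z == y3].
Proof.
move=> e1 e2 e3 n12 n31 n32.
have [y [_ _ E]] := third_neighbour e1 e2 n12.
have := E y3; rewrite e3 !inE (negPf n31) (negPf n32) /= => /esym/eqP ->.
by rewrite E !inE.
Qed.

Lemma edge_neq x y : e x y -> x != y.
Proof. by move/bip_e; apply: contraNneq => ->. Qed.

(** The vertices come in cyclic order. Only opposite ones are required to differ, since adjacent
    ones have different colours. *)
Definition square x y x' y' :=
  [&& e x y, e y x', e x' y', e y' x, x != x' & y != y'].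

Lemma square_rot x y x' y' : square x y x' y' -> square y x' y' x.
Proof.
case/and5P=> e1 e2 e3 e4 /andP[n1 n2].
by rewrite /square e1 e2 e3 e4 n2 eq_sym n1.
Qed.

Lemma square_flip x y x' y' : square x y x' y' -> square x y' x' y.
Proof.
case/and5P=> e1 e2 e3 e4 /andP[n1 n2].
by rewrite /square sym_e e4 sym_e e3 sym_e e2 sym_e e1 n1 eq_sym.
Qed.

Lemma square_rev x y x' y' : square x y x' y' -> square y x y' x'.
Proof. by move/square_flip/square_rot/square_rot/square_rot. Qed.

Definition perfect_matching (m : T -> T) := involutive m /\ forall x, e x (m x).

(** For a perfect matching [m], such a square is a whole cycle of the complementary 2-factor. *)
Definition missed (m : T -> T) x y x' y' :=
  [&& square x y x' y', m x != y, m y != x', m x' != y' & m y' != x].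

Lemma inv_eq (m : T -> T) x y : involutive m -> (m x == y) = (m y == x).
Proof. by move=> mK; rewrite -(can_eq mK) mK eq_sym. Qed.

Lemma missed_rot m x y x' y' : missed m x y x' y' -> missed m y x' y' x.
Proof. by case/and5P=> /square_rot *; apply/and5P. Qed.

Lemma missed_flip m x y x' y' : involutive m ->
  missed m x y x' y' -> missed m x y' x' y.
Proof.
move=> mK /and5P[/square_flip sq n1 n2 n3 n4]; apply/and5P; split=> //.
all: by rewrite inv_eq.
Qed.

Lemma missed_rev m x y x' y' : involutive m ->
  missed m x y x' y' -> missed m y x y' x'.
Proof. by move=> mK /(missed_flip mK)/missed_rot/missed_rot/missed_rot. Qed.

(** The square takes two of the three edges at [x], and the matching edge is the third. *)
Lemma missed_neighbours m x y x' y' z : perfect_matching m ->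
  missed m x y x' y' -> e x z -> [|| z == y, z == y' | z == m x].
Proof.
move=> [mK me] /and5P[/and5P[e1 e2 e3 e4 /andP[n1 n2]] m1 m2 m3 m4].
apply: neighbours3 => //; first by rewrite sym_e.
by rewrite inv_eq.
Qed.

(* A common neighbour of y and y' outside the square would be the partner of both. *)
Lemma missed_common_neighbour m x y x' y' z : perfect_matching m ->
  missed m x y x' y' -> e y z -> e y' z -> (z == x) || (z == x').
Proof.
move=> pm ms eyz ey'z.
have := missed_neighbours pm (missed_rot ms) eyz.
have := missed_neighbours pm (missed_rot (missed_rot (missed_rot ms))) ey'z.
case: eqP => //= _; case: eqP => //= _ /eqP zy' /eqP zy.
case: pm => mK _; case/and5P: ms => /and5P[_ _ _ _ /andP[_ /eqP[]]].
by apply: (can_inj mK); rewrite -zy -zy'.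
Qed.

(** The edge [a1 b2] leaves the matching, and the danger is a newly missed square [a1 b2 y z]
    through it. Here [z] must be [b3], because the other neighbours of [a1] are [b2] and its new
    partner [b1]. Then [y] is [a3] or [m b3]. In the first case [b2] would be a neighbour of [a3],
    hence [b1], [b3] or [m a3], none of which is possible. In the second, [y z] is an edge of [m'],
    as [b3] lies off the exchanged square. *)
Lemma missed_swap_aux m m' a1 b1 a2 b2 a3 b3 y z :
  perfect_matching m -> involutive m' ->
  missed m a1 b1 a3 b3 -> square a1 b1 a2 b2 -> m a1 = b2 ->
  m' a1 = b1 ->
  (forall x, x \notin [:: a1; b1; a2; b2] -> m' x = m x) ->
  ~~ missed m' a1 b2 y z.
Proof.
move=> pm m'K ms sq ma1 m'a1 m'E.
apply/negP=> /and5P[/and5P[e1 e2 e3 e4 /andP[n1 n2]] m1 m2 m3 m4].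
have ea1z : e a1 z by rewrite sym_e.
have mK := pm.1.
have zb3 : z = b3.
  have := missed_neighbours pm ms ea1z; rewrite ma1 (eq_sym z b2) (negPf n2) orbF.
  case/orP=> /eqP // zb1; case/eqP: m4.
  by rewrite zb1 -m'a1 m'K.
move: ms sq => ms; have := ms.
case/and5P=> /and5P[f1 f2 f3 f4 /andP[k1 k2]] l1 l2 l3 l4.
case/and5P=> g1 g2 g3 g4 /andP[h1 h2].
have eb3y : e b3 y by rewrite sym_e -zb3.
have := missed_neighbours pm (missed_rot (missed_rot (missed_rot ms))) eb3y.
rewrite eq_sym (negPf n1) /=; case/orP=> /eqP yE.
  subst y.
  have ea3b2 : e a3 b2 by rewrite sym_e.
  case/or3P: (missed_neighbours pm (missed_rot (missed_rot ms)) ea3b2).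
  - by rewrite -zb3 (negPf n2).
  - by rewrite eq_sym (negPf h2).
  - by rewrite -ma1 (can_eq mK) (negPf k1).
case/negP: m3; rewrite yE zb3 -inv_eq // m'E //.
have na2 : b3 != a2.
  apply/eqP=> ba; move: (bip_e f4) (bip_e g1) (bip_e g2); rewrite ba.
  by case: (c _); case: (c _); case: (c _).
have eb3a1 : e a1 b3 by rewrite -zb3.
rewrite !inE !negb_or na2 -{3}zb3 (eq_sym z) n2 (eq_sym b3 a1) (edge_neq eb3a1).
by rewrite (eq_sym b3) k2.
Qed.

Lemma missed_swap m a1 b1 a2 b2 a3 b3 :
  perfect_matching m -> missed m a1 b1 a3 b3 -> square a1 b1 a2 b2 ->
  m a1 = b2 -> m b1 = a2 ->
  exists m', [/\ perfect_matching m', m' a1 = b1 &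
    forall x y x' y', missed m' x y x' y' -> missed m x y x' y'].
Proof.
move=> pm ms sq ma1 mb1; have [mK me] := pm.
have mb2 : m b2 = a1 by rewrite -ma1.
have ma2 : m a2 = b1 by rewrite -mb1.
case/and5P: (sq) => e1 e2 e3 e4 /andP[n1 n2].
have sq' := square_rev sq.
have n3 := edge_neq e1; have n4 := edge_neq e2.
have n5 := edge_neq e3; have n6 := edge_neq e4.
(* The two perfect matchings of the square [a1 b1 a2 b2] are exchanged. *)
pose m' x := if x == a1 then b1 else if x == b1 then a1 else
             if x == a2 then b2 else if x == b2 then a2 else m x.
have m'a1 : m' a1 = b1 by rewrite /m' eqxx.
have m'b1 : m' b1 = a1 by rewrite /m' eqxx eq_sym (negPf n3).
have m'a2 : m' a2 = b2 by rewrite /m' eqxx eq_sym (negPf n1) eq_sym (negPf n4).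
have m'b2 : m' b2 = a2.
  by rewrite /m' eqxx (negPf n6) (eq_sym b2 b1) (negPf n2) (eq_sym b2 a2) (negPf n5).
have m'E x : x \notin [:: a1; b1; a2; b2] -> m' x = m x.
  by rewrite !inE !negb_or /m' => /and4P[/negPf-> /negPf-> /negPf-> /negPf->].
have mout x : x \notin [:: a1; b1; a2; b2] -> m x \notin [:: a1; b1; a2; b2].
  rewrite !inE !negb_or => /and4P[x1 x2 x3 x4].
  by rewrite ![m x == _]inv_eq // ma1 mb1 ma2 mb2 !(eq_sym _ x) x1 x2 x3 x4.
have m'K : involutive m'.
  move=> x; case xin: (x \in [:: a1; b1; a2; b2]).
    move: xin; rewrite !inE => /or4P[] /eqP->.
    - by rewrite m'a1.
    - by rewrite m'b1.
    - by rewrite m'a2.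
    - by rewrite m'b2.
  by rewrite !m'E ?mout ?mK ?xin.
exists m'; split=> //.
  split=> // x; case xin: (x \in [:: a1; b1; a2; b2]); last by rewrite m'E ?xin.
  move: xin; rewrite !inE => /or4P[] /eqP->.
  - by rewrite m'a1.
  - by rewrite m'b1 sym_e.
  - by rewrite m'a2.
  - by rewrite m'b2 sym_e.
have no1 y z : ~~ missed m' a1 b2 y z.
  exact: (missed_swap_aux _ _ pm m'K ms sq ma1 m'a1 m'E).
have no2 y z : ~~ missed m' b1 a2 y z.
  apply: (missed_swap_aux _ _ pm m'K (missed_rev mK ms) sq' mb1 m'b1).
  move=> x xN; apply: m'E; apply: contra xN; rewrite !inE.
  by case/or4P=> /eqP->; rewrite eqxx ?orbT.
(* The only edges of [m] absent from [m'] are [a1 b2] and [b1 a2], and [no1], [no2] show that no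
   square missed by [m'] contains them. *)
have key x y x' y' : missed m' x y x' y' -> m x != y.
  move=> ms'; apply/eqP=> mx.
  have [xin|/m'E xE] := boolP (x \in [:: a1; b1; a2; b2]); last first.
    by case/and5P: ms' => _; rewrite xE mx eqxx.
  have ms2 := missed_rev m'K ms'.
  move: xin mx; rewrite !inE => /or4P[] /eqP xE mx; subst x.
  - by move: ms'; rewrite -mx ma1; apply/negP.
  - by move: ms'; rewrite -mx mb1; apply/negP.
  - move: ms2; rewrite -mx ma2; apply/negP.
    exact: no2.
  - move: ms2; rewrite -mx mb2; apply/negP.
    exact: no1.
move=> x y x' y' ms'; apply/and5P; split.
- by case/and5P: ms'.
- exact: key ms'.
- exact: key (missed_rot ms').
- exact: key (missed_rot (missed_rot ms')).
- exact: key (missed_rot (missed_rot (missed_rot ms'))).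
Qed.

Lemma improve_matching m x y x' y' u z v :
  perfect_matching m -> missed m x y x' y' ->
  square x u z v -> ~~ missed m x u z v ->
  exists m', [/\ perfect_matching m', ~~ missed m' x y x' y' &
    forall x y x' y', missed m' x y x' y' -> missed m x y x' y'].
Proof.
move=> pm ms sq hit; have [mK me] := pm.
(* The hit square must use the edge from [x] to [m x]. Otherwise [u] and [v] are [y] and [y'], so
   [z] is their common neighbour [x'] and the hit square is the missed one. *)
wlog vE : u v sq hit / v = m x.
  move=> wl; have [|vN] := eqVneq v (m x); first exact: wl sq hit.
  have [uE|uN] := eqVneq u (m x).
    apply: (wl v u) => //; first exact: square_flip.
    by apply: contra hit => /(missed_flip mK).
  case/negP: hit; move: (sq) => /and5P[e1 e2 e3 e4 /andP[n1 n2]].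
  have ev : e x v by rewrite sym_e.
  have := missed_neighbours pm ms e1; rewrite (negPf uN) orbF => uE.
  have := missed_neighbours pm ms ev; rewrite (negPf vN) orbF => vE.
  have [yz y'z] : e y z /\ e y' z.
    case/orP: uE n2 => /eqP uE; subst u; case/orP: vE => /eqP vE; subst v.
    - by rewrite eqxx.
    - by rewrite e2 sym_e e3.
    - by rewrite e2 sym_e e3.
    - by rewrite eqxx.
  have := missed_common_neighbour pm ms yz y'z; rewrite eq_sym (negPf n1) => /eqP zE.
  case/orP: uE n2 => /eqP uE; subst u; case/orP: vE => /eqP vE; subst v.
  - by rewrite eqxx.
  - by rewrite zE.
  - by rewrite zE => _; apply: missed_flip.
  - by rewrite eqxx.
(* The other neighbour [u] of [x] in the hit square is then [y] or [y'], so the two squares share an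
   edge. *)
wlog uE : y y' ms / u = y.
  move=> wl; case/and5P: (sq) => e1 _ _ _ /andP[_ n2].
  have := missed_neighbours pm ms e1; rewrite -vE (negPf n2) orbF.
  case/orP=> /eqP uE; first exact: wl ms uE.
  have [m' [pm' nm' sub']] := wl _ _ (missed_flip mK ms) uE.
  exists m'; split=> //; apply: contra nm'; apply: missed_flip.
  by case: pm'.
subst u v; case/and5P: (sq) => e1 e2 e3 e4 /andP[n1 n2].
(* The remaining candidate [z = x'] would make [m x] a neighbour of [x'], hence [y], [y'] or [m x'],
   and each is excluded. *)
have my : m y = z.
  case/or3P: (missed_neighbours pm (missed_rot ms) e2) => /eqP zE //.
  - subst z; case/and5P: (ms) => /and5P[f1 f2 f3 f4 /andP[k1 k2]] l1 l2 l3 l4.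
    case/or3P: (missed_neighbours pm (missed_rot (missed_rot ms)) e3) => /eqP E.
    + by rewrite (inv_eq _ _ mK) E eqxx in l4.
    + by rewrite E eqxx in n2.
    + by case/eqP: k1; apply: (can_inj mK).
  - by rewrite zE eqxx in n1.
have [m' [pm' m'x sub]] := missed_swap pm ms sq erefl my.
by exists m'; split=> //; apply/negP=> /and5P[_]; rewrite m'x eqxx.
Qed.

Definition square_set (S : {set T}) := [exists x, exists y, exists x', exists y',
  square x y x' y' && (S == [set x; y; x'; y'])].

Lemma square_setP x y x' y' : square x y x' y' -> square_set [set x; y; x'; y'].
Proof.
move=> sq; apply/existsP; exists x; apply/existsP; exists y.
by apply/existsP; exists x'; apply/existsP; exists y'; rewrite sq eqxx.
Qed.

Lemma set4_rot (x y z t : T) : [set x; y; z; t] = [set y; z; t; x].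
Proof. by apply/setP=> u; rewrite !inE; do !case: (_ == _). Qed.

Lemma square_through S z : square_set S -> z \in S ->
  exists y x' y', square z y x' y' /\ S = [set z; y; x'; y'].
Proof.
case/existsP=> x /existsP[y /existsP[x' /existsP[y' /andP[sq /eqP->]]]].
rewrite !inE -!orbA => /or4P[] /eqP->.
- by exists y, x', y'.
- by exists x', y', x; split; [apply: square_rot | apply: set4_rot].
- exists y', x, y; split; first by do 2!apply: square_rot.
  by rewrite set4_rot set4_rot.
- exists x, y, x'; split; first by do 3!apply: square_rot.
  by rewrite -set4_rot.
Qed.

Lemma missed_through m x y x' y' z : missed m x y x' y' ->
  z \in [set x; y; x'; y'] -> exists u v w,
    missed m z u v w /\ forall m', missed m' x y x' y' -> missed m' z u v w.
Proof.
move=> ms; rewrite !inE -!orbA => /or4P[] /eqP->.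
- by exists y, x', y'.
- by exists x', y', x; split=> [|m']; apply: missed_rot.
- by exists y', x, y; split=> [|m' ?]; do 2!apply: missed_rot.
- by exists x, y, x'; split=> [|m' ?]; do 3!apply: missed_rot.
Qed.

(** * Contracting a family of disjoint squares *)

Section Contraction.

Variable F : {set {set T}}.
Hypotheses (tiF : trivIset F) (sqF : forall S, S \in F -> square_set S).

Lemma pblock_square x : x \in cover F -> exists y x' y',
  square x y x' y' /\ pblock F x = [set x; y; x'; y'].
Proof.
move=> xF; apply: square_through; first by apply/sqF/pblock_mem.
by rewrite mem_pblock.
Qed.

Lemma in_pblock_cover x y : y \in pblock F x -> (x \in cover F) && (y \in cover F).
Proof.
rewrite /pblock; case: pickP => [S /andP[SF xS] yS|]; last by rewrite inE.
by apply/andP; split; apply/bigcupP; exists S.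
Qed.

Lemma in_pblockC x y : (y \in pblock F x) = (x \in pblock F y).
Proof.
suff H u v : v \in pblock F u -> u \in pblock F v by apply/idP/idP; apply: H.
move=> vu; have /andP[uF _] := in_pblock_cover vu.
by rewrite (same_pblock tiF vu) mem_pblock.
Qed.

(* The class map of the contraction that identifies, in each square of F, the
   two vertices of equal colour. *)
Definition corner x := odflt x [pick y in pblock F x | c y == c x].

Lemma corner_color x : c (corner x) = c x.
Proof. by rewrite /corner; case: pickP => //= y /andP[_ /eqP]. Qed.

Lemma corner_out x : x \notin cover F -> corner x = x.
Proof.
move=> xN; rewrite /corner; case: pickP => //= y /andP[/in_pblock_cover].
by rewrite (negPf xN).
Qed.

Lemma corner_in x : x \in cover F -> corner x \in pblock F x.
Proof.
move=> xF; rewrite /corner; case: pickP => /= [y /andP[] //|/(_ x)].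
by rewrite mem_pblock xF eqxx.
Qed.

Lemma corner_same x y : y \in pblock F x -> c y = c x -> corner y = corner x.
Proof.
move=> yx cyx; have /andP[xF _] := in_pblock_cover yx.
rewrite /corner (same_pblock tiF yx) cyx; case: pickP => //= /(_ x).
by rewrite mem_pblock xF eqxx.
Qed.

Lemma corner_eq x y : corner x = corner y -> y = x \/ y \in pblock F x.
Proof.
move=> hxy; have [xF|/corner_out xE] := boolP (x \in cover F); last first.
  have [/corner_in|/corner_out yE] := boolP (y \in cover F).
    by rewrite -hxy xE in_pblockC; right.
  by left; rewrite -yE -hxy.
have := corner_in xF; have [/corner_in|/corner_out yE] := boolP (y \in cover F).
  rewrite -hxy in_pblockC => yc xc; right.
  by rewrite -(same_pblock tiF xc).
by rewrite hxy yE; right.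
Qed.

Lemma square_colors x y x' y' : square x y x' y' ->
  [/\ c x' = c x, c y = ~~ c x & c y' = ~~ c x].
Proof.
case/and5P=> /bip_e + /bip_e + /bip_e + /bip_e + _.
by case: (c x); case: (c y); case: (c x'); case: (c y').
Qed.

Lemma corner_class x y x' y' z :
  square x y x' y' -> pblock F x = [set x; y; x'; y'] ->
  (corner z == corner x) = (z == x) || (z == x').
Proof.
move=> sq bE; have [cx' cy cy'] := square_colors sq.
have xx' : corner x' = corner x by apply: corner_same; rewrite // bE !inE eqxx ?orbT.
apply/eqP/orP=> [hz|[/eqP->//|/eqP->//]].
have cz : c z = c x by rewrite -corner_color hz corner_color.
case: (corner_eq (esym hz)) => [->|]; first by left.
rewrite bE !inE -!orbA => /or4P[] zE; rewrite ?zE; [by left| |by right|].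
  by move: cz cy; rewrite (eqP zE) => ->; case: (c x).
by move: cz cy'; rewrite (eqP zE) => ->; case: (c x).
Qed.

(** Both vertices are sent to the same one of the two, so exactly one represents the pair. *)
Lemma corner_pair x y x' y' :
  square x y x' y' -> pblock F x = [set x; y; x'; y'] ->
  (corner x == x) + (corner x' == x') = 1.
Proof.
move=> sq bE; have := corner_class (corner x) sq bE.
have := corner_class x' sq bE; rewrite eqxx orbT => /eqP->.
have xF : corner x \in pblock F x.
  by apply: corner_in; rewrite -mem_pblock bE !inE eqxx.
have -> : corner (corner x) = corner x.
  by apply: corner_same; rewrite ?corner_color.
have nx : x != x' by case/and5P: sq => _ _ _ _ /andP[].
rewrite eqxx => /esym/orP[] /eqP->; rewrite eqxx.
  by rewrite (negPf nx).
by rewrite eq_sym (negPf nx).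
Qed.

(* Of the four edges of a square of F only one is kept: it stands for the edge
   joining the two contracted vertices. *)
Definition contracted x y :=
  e x y && ((y \in pblock F x) ==> (corner x == x) && (corner y == y)).

Lemma contracted_sym : symmetric contracted.
Proof.
move=> x y; rewrite /contracted sym_e in_pblockC.
by rewrite [(corner x == x) && _]andbC.
Qed.

(** The edge leaving the square is always kept. If [x] represents its pair, one edge inside the
    square is kept as well, namely the one to whichever of [y], [y'] represents the opposite pair.
    The two vertices of a class therefore contribute 2 + 1 = 3. *)
Lemma contracted_deg x y x' y' :
  square x y x' y' -> pblock F x = [set x; y; x'; y'] ->
  #|[set v | contracted x v]| = (corner x == x).+1.
Proof.
move=> sq bE; have [cx' cy cy'] := square_colors sq.
case/and5P: (sq) => e1 e2 e3 e4 /andP[n1 n2].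
have e4' : e x y' by rewrite sym_e.
have [w [wy wy' wE]] := third_neighbour e1 e4' n2.
have ew : e x w by rewrite wE !inE eqxx !orbT.
have wb : w \notin pblock F x.
  rewrite bE !inE (negPf wy) (negPf wy') !orbF eq_sym (negPf (edge_neq ew)) /=.
  by apply: contraTneq (bip_e ew) => ->; rewrite cx' eqxx.
have bE' : pblock F y = [set y; x'; y'; x].
  by rewrite -set4_rot -bE; apply: same_pblock; rewrite // bE !inE eqxx orbT.
have := corner_pair (square_rot sq) bE'.
have -> : [set v | contracted x v] = [set v in [:: y; y'; w] | contracted x v].
  apply/setP=> v; rewrite inE [in RHS]inE; case xv: (contracted x v); rewrite ?andbF //.
  by case/andP: xv; rewrite wE => ->.
rewrite -sum1_card big_mkcond /=.
rewrite (eq_bigr (fun v => ((v == y) && contracted x v) + ((v == y') && contracted x v)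
   + ((v == w) && contracted x v))); last first.
  move=> v _; rewrite !inE; move: (contracted x v) => b.
  have [->|vy] := eqVneq v y; first by rewrite (negPf n2) (eq_sym y) (negPf wy); case: b.
  have [->|vy'] := eqVneq v y'; first by rewrite (eq_sym y') (negPf wy'); case: b.
  by case: (v == w); case: b.
have pt z : \sum_v ((v == z) && contracted x v : nat) = contracted x z.
  rewrite (bigD1 z) //= eqxx big1 ?addn0 // => v /negPf-> //.
rewrite !big_split /= !pt /contracted e1 e4' ew (negPf wb) bE !inE !eqxx !orbT /=.
by case: (corner x == x); case: (corner y == y); case: (corner y' == y').
Qed.

Lemma contracted_regular x :
  \sum_(u | corner u == corner x) #|[set v | contracted u v]| = 3.
Proof.
have [xF|xN] := boolP (x \in cover F).
  have [y [x' [y' [sq bE]]]] := pblock_square xF.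
  have nx : x != x' by case/and5P: sq => _ _ _ _ /andP[].
  have bE' : pblock F x' = [set x'; y'; x; y].
    rewrite set4_rot set4_rot -bE; apply: same_pblock; rewrite // bE !inE eqxx !orbT //.
  rewrite (eq_bigl _ _ (fun u => corner_class u sq bE)).
  rewrite (bigD1 x) ?eqxx //= (bigD1 x') ?eqxx ?orbT 1?eq_sym //= big_pred0; last first.
    by move=> u; case: (u == x); case: (u == x').
  rewrite (contracted_deg sq bE) (contracted_deg (square_rot (square_rot sq)) bE').
  by have := corner_pair sq bE; lia.
rewrite (big_pred1 x) => [|u].
  rewrite -(cubic_e x); apply: eq_card => v; rewrite !inE /contracted.
  case: (v \in _) / idP => [/in_pblock_cover|_]; first by rewrite (negPf xN).
  by rewrite andbT.
apply/eqP/eqP=> [h|->//]; case: (corner_eq (esym h)) => // /in_pblock_cover.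
by rewrite (negPf xN).
Qed.

Lemma matching_hitting_family : exists m, perfect_matching m /\
  forall x y x' y', square x y x' y' -> [set x; y; x'; y'] \in F -> ~~ missed m x y x' y'.
Proof.
have bip_k x y : contracted x y -> c x != c y by case/andP=> /bip_e.
have [N [symN Nk injN totN]] :=
  quotient_matching (isT : 0 < 3) contracted_sym bip_k corner_color contracted_regular.
(* [N] covers exactly one vertex of each contracted pair, so every square of [F] keeps two uncovered
   vertices, one of each colour. *)
pose unm x := ~~ [exists y, N x y].
have unmP x y : N x y -> unm x = false by move=> Nxy; apply/negbF/existsP; exists y.
have unm_pair x y x' y' : square x y x' y' -> pblock F x = [set x; y; x'; y'] ->
    unm x' = ~~ unm x.
  move=> sq bE; have nx : x != x' by case/and5P: sq => _ _ _ _ /andP[].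
  have hx' : corner x' = corner x by apply/eqP; rewrite (corner_class _ sq bE) eqxx orbT.
  have one : unm x || unm x'.
    apply: contraT; rewrite negb_or !negbK => /andP[/existsP[u Nu] /existsP[v Nv]].
    by case: (injN _ _ _ _ Nu Nv (esym hx')) => xx'; rewrite xx' eqxx in nx.
  have [u [v [/eqP]]] := totN x; rewrite (corner_class _ sq bE).
  by case/orP=> /eqP-> /unmP uE; move: one; rewrite uE ?orbF /= => ->.
(* The lift adds to [N] the edge joining the two uncovered vertices of each square; having different
   colours, they are adjacent on it. *)
pose M x y := N x y || [&& unm x, unm y, y \in pblock F x & c x != c y].
have opp x y x' y' z : square x y x' y' -> pblock F x = [set x; y; x'; y'] ->
    z \in pblock F x -> c x != c z -> (z == y) || (z == y').
  move=> sq bE; have [cx' cy cy'] := square_colors sq.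
  rewrite bE !inE -!orbA => /or4P[] /eqP->; rewrite ?cx' ?eqxx ?orbT //.
have next_block x y x' y' : square x y x' y' -> pblock F x = [set x; y; x'; y'] ->
    pblock F y = [set y; x'; y'; x].
  by move=> sq bE; rewrite -set4_rot -bE; apply: same_pblock; rewrite // bE !inE eqxx orbT.
have symM : symmetric M.
  by move=> x y; rewrite /M symN in_pblockC [c x == c y]eq_sym andbCA.
have funM x y z : M x y -> M x z -> y = z.
  case/orP=> [Nxy|/and4P[ux uy yx cxy]] /orP[Nxz|/and4P[ux' uz zx cxz]].
  - by case: (injN _ _ _ _ Nxy Nxz erefl).
  - by rewrite (unmP _ _ Nxy) in ux'.
  - by rewrite (unmP _ _ Nxz) in ux.
  have /andP[xF _] := in_pblock_cover yx.
  have [u [x' [v [sq bE]]]] := pblock_square xF.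
  have uv := unm_pair _ _ _ _ (square_rot sq) (next_block _ _ _ _ sq bE).
  case/orP: (opp _ _ _ _ _ sq bE yx cxy) => /eqP yE;
  case/orP: (opp _ _ _ _ _ sq bE zx cxz) => /eqP zE; subst y z => //.
  + by rewrite uv uy in uz.
  + by rewrite uv uz in uy.
have totM_un x : x \in cover F -> unm x -> exists y, M x y.
  move=> xF ux; have [u [x' [v [sq bE]]]] := pblock_square xF.
  have [_ cu cv] := square_colors sq.
  have uv := unm_pair _ _ _ _ (square_rot sq) (next_block _ _ _ _ sq bE).
  have [uu|nu] := boolP (unm u).
    by exists u; rewrite /M ux uu bE cu !inE eqxx orbT; case: (c x); rewrite orbT.
  by exists v; rewrite /M ux uv nu bE cv !inE eqxx !orbT; case: (c x); rewrite orbT.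
have totM x : exists y, M x y.
  have [ux|] := boolP (unm x); last first.
    by rewrite negbK => /existsP[y Nxy]; exists y; rewrite /M Nxy.
  have [xF|xN] := boolP (x \in cover F); first exact: totM_un.
  have [u [v [hu Nuv]]] := totN x.
  case: (corner_eq (esym hu)) => [ux'|/in_pblock_cover]; last by rewrite (negPf xN).
  by rewrite ux' in Nuv; rewrite (unmP _ _ Nuv) in ux.
have [m [mK mM]] := rel_matching symM funM totM.
exists m; split.
  split=> // x; case/orP: (mM x) => [/Nk/andP[] //|/and4P[_ _ mx cx]].
  have /andP[xF _] := in_pblock_cover mx.
  have [u [x' [v [sq bE]]]] := pblock_square xF.
  case/and5P: (sq) => e1 _ _ e4 _.
  by case/orP: (opp _ _ _ _ _ sq bE mx cx) => /eqP-> //; rewrite sym_e.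
move=> x y x' y' sq SF; have bE : pblock F x = [set x; y; x'; y'].
  by apply: def_pblock; rewrite // !inE eqxx.
(* One of [x] and [x'] is uncovered by [N], and half a turn of the square exchanges them. The
   partner of the uncovered one lies on the square. *)
wlog ux : x y x' y' sq SF bE / unm x.
  move=> wl; have [ux|nux] := boolP (unm x); first exact: wl.
  apply: (contra (@missed_rot _ _ _ _ _)); apply: (contra (@missed_rot _ _ _ _ _)).
  have bE1 := next_block _ _ _ _ sq bE.
  have bE2 := next_block _ _ _ _ (square_rot sq) bE1.
  apply: wl => //; first by do 2!apply: square_rot.
    by rewrite set4_rot set4_rot.
  by rewrite (unm_pair _ _ _ _ sq bE).
apply/negP=> /and5P[_ m1 _ _ m4].
case/orP: (mM x) => [/unmP|/and4P[_ _ mx cx]]; first by rewrite ux.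
case/orP: (opp _ _ _ _ _ sq bE mx cx) => /eqP E; first by rewrite E eqxx in m1.
by rewrite (inv_eq _ _ mK) E eqxx in m4.
Qed.

End Contraction.

(** * A perfect matching meeting every square, and the 2-factor it leaves *)

(** Induction on the number of missed squares. A missed square meets some [Q] in the maximal family
    [F], and [Q] is hit, so [improve_matching] applies. It creates no missed square, so the squares
    of [F] stay hit and the induction continues. *)
Lemma matching_hitting_squares : exists m, perfect_matching m /\
  forall x y x' y', ~~ missed m x y x' y'.
Proof.
pose P (F : {set {set T}}) := trivIset F && [forall S in F, square_set S].
have P0 : P set0.
  apply/andP; split; first by apply/trivIsetP=> A B; rewrite inE.
  by apply/forall_inP=> S; rewrite inE.
have [F /maxsetP[/andP[tiF /forall_inP sqF] maxF] _] := maxset_exists P0.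
(* A square disjoint from all members of [F] could be added to it. *)
have meet S : square_set S -> S \notin F -> exists Q z, [/\ Q \in F, z \in S & z \in Q].
  move=> sqS SF; have [/exists_inP[Q QF /pred0Pn[z /andP[zS zQ]]]|] :=
    boolP [exists Q in F, ~~ [disjoint S & Q]]; first by exists Q, z.
  rewrite negb_exists_in => /forall_inP dis; case/negP: SF.
  have set0F : set0 \notin F.
    apply/negP=> /sqF/existsP[x /existsP[y /existsP[x' /existsP[y' /andP[_]]]]].
    by move/eqP/setP/(_ x); rewrite !inE eqxx.
  have [|ti _] := trivIsetU1 _ tiF set0F (A := S); first by move=> Q /dis; rewrite negbK.
  rewrite -(maxF (S |: F)) ?subsetUr // ?setU11 // /P ti; apply/forall_inP=> Q.
  by rewrite in_setU1 => /predU1P[->|/sqF].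
have [m0 [pm0 hit0]] := matching_hitting_family tiF sqF.
pose bad m := [set q : T * T * (T * T) | missed m q.1.1 q.1.2 q.2.1 q.2.2].
have [n] := ubnP #|bad m0|; elim: n m0 pm0 hit0 => // n IHn m pm hit /ltnSE len.
have [b0|[[[x y] [x' y']]]] := set_0Vmem (bad m).
  exists m; split=> // x y x' y'; apply/negP=> ms.
  by have := in_set0 ((x, y), (x', y')); rewrite -b0 inE ms.
rewrite inE /= => ms; have sq : square x y x' y' by case/and5P: ms.
have SF : [set x; y; x'; y'] \notin F by apply: contraL ms; apply: hit.
have [Q [z [QF zS zQ]]] := meet _ (square_setP sq) SF.
have [u [v [w [ms' msE]]]] := missed_through ms zS.
have [a [b [d [sqQ QE]]]] := square_through (sqF _ QF) zQ.
have hitQ : ~~ missed m z a b d by apply: hit; rewrite -?QE.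
have [m' [pm' nm' sub]] := improve_matching pm ms' sqQ hitQ.
apply: (IHn m' pm') => [x1 y1 x2 y2 sq1 S1F|].
  by apply: contra (hit _ _ _ _ sq1 S1F); apply: sub.
apply: leq_trans len; apply/proper_card/properP; split.
  by apply/subsetP=> q; rewrite !inE; apply: sub.
by exists ((x, y), (x', y')); rewrite !inE //=; apply: contra nm'; apply: msE.
Qed.

Lemma remove_matching (R : rel T) k m : (forall x, #|[set v | R x v]| = k.+1) ->
  (forall x, R x (m x)) -> forall x, #|[set v | R x v && (v != m x)]| = k.
Proof.
move=> Rk mR x; have := Rk x; rewrite (cardsD1 (m x)) inE mR => -[<-].
by apply: eq_card => v; rewrite !inE andbC.
Qed.

(* s runs along the cycles of the 2-factor complementary to the matching m. *)
Lemma square_free_two_factor : exists m s : T -> T, [/\ involutive m, injective s,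
  forall x, e x (s x),
  forall x y, e x y -> [|| y == m x, y == s x | s y == x] &
  forall x, s (s x) != x /\ iter 4 s x != x].
Proof.
have [m [[mK me] hit]] := matching_hitting_squares.
pose R2 x y := e x y && (y != m x).
have R2k : forall x, #|[set v | R2 x v]| = 2 := remove_matching cubic_e me.
have symR2 : symmetric R2 by move=> x y; rewrite /R2 sym_e eq_sym (inv_eq _ _ mK) eq_sym.
have bipR2 x y : R2 x y -> c x != c y by case/andP=> /bip_e.
have [m2 [m2K m2R]] := regular_perfect_matching (isT : 0 < 2) symR2 bipR2 R2k.
pose R3 x y := R2 x y && (y != m2 x).
have R3k : forall x, #|[set v | R3 x v]| = 1 := remove_matching R2k m2R.
have symR3 : symmetric R3 by move=> x y; rewrite /R3 symR2 eq_sym (inv_eq _ _ m2K) eq_sym.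
have bipR3 x y : R3 x y -> c x != c y by case/andP=> /bipR2.
have [m3 [m3K m3R]] := regular_perfect_matching (isT : 0 < 1) symR3 bipR3 R3k.
have e2 x : e x (m2 x) by case/andP: (m2R x).
have e3 x : e x (m3 x) by case/andP: (m3R x) => /andP[].
have n2 x : m2 x != m x by case/andP: (m2R x).
have n3 x : m3 x != m x by case/andP: (m3R x) => /andP[].
have n32 x : m3 x != m2 x by case/andP: (m3R x).
have c2 x : c (m2 x) = ~~ c x by have := bip_e (e2 x); case: (c x); case: (c _).
have c3 x : c (m3 x) = ~~ c x by have := bip_e (e3 x); case: (c x); case: (c _).
(* The 2-factor splits into the perfect matchings [m2] and [m3]. Following [m2] from one colour and
   [m3] from the other orients each cycle consistently. *)
pose s x := if c x then m2 x else m3 x.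
have cs x : c (s x) = ~~ c x by rewrite /s; case: ifP => cx; rewrite ?c2 ?c3 cx.
have es x : e x (s x) by rewrite /s; case: ifP.
have s_inj : injective s.
  move=> x y sxy; have cxy : c x = c y by apply: negb_inj; rewrite -!cs sxy.
  by move: sxy; rewrite /s cxy; case: ifP => _; apply: can_inj.
have ms x : m x != s x by rewrite /s eq_sym; case: ifP.
have ms' x : m (s x) != x by rewrite inv_eq.
have ss x : s (s x) != x.
  rewrite {1}/s cs /s; case: (c x) => /=; first by rewrite (inv_eq _ _ m3K).
  by rewrite (inv_eq _ _ m2K) eq_sym.
exists m, s; split=> // [x y exy|x].
  have := neighbours3 (me x) (e2 x) (e3 x) _ (n3 x) (n32 x) exy.
  rewrite eq_sym n2 => /(_ isT); case/or3P=> /eqP->; rewrite ?eqxx //.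
    by rewrite /s c2 m2K; case: (c x); rewrite eqxx ?orbT //= orbC.
  by rewrite /s c3 m3K; case: (c x); rewrite eqxx ?orbT.
(* Returning after four steps would trace a square missed by [m]. *)
split=> //; apply/eqP=> /= s4.
case/negP: (hit x (s x) (s (s x)) (s (s (s x)))).
have sq : square x (s x) (s (s x)) (s (s (s x))).
  rewrite /square !es -{2}s4 es /= eq_sym ss eq_sym; exact: ss.
by apply/and5P; split=> //; rewrite -{2}s4.
Qed.

End CubicBipartite.

(** * Cutting the cycles of the 2-factor into induced paths of order 3 and 4 *)

Section CyclePartition.

Variables (T : finType) (e : rel T) (c : T -> bool) (m s : T -> T).
Hypotheses (sym_e : symmetric e) (bip_e : forall x y, e x y -> c x != c y).
Hypotheses (mK : involutive m) (s_inj : injective s) (es : forall x, e x (s x)).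
Hypothesis e_ms : forall x y, e x y -> [|| y == m x, y == s x | s y == x].
Hypothesis s24_neq : forall x, s (s x) != x /\ iter 4 s x != x.

(** The lower bound is 3, rather than the 2 of [induced_path], because it yields the bound on the
    number of parts. *)
Definition good_piece (t : seq T) := [/\ uniq t, 3 <= size t &
  forall (x0 : T) (i j : nat), i < size t -> j < size t ->
    e (nth x0 t i) (nth x0 t j) = (j == i.+1) || (i == j.+1)].

Lemma color_iter i x : c (iter i s x) = odd i (+) c x.
Proof.
elim: i => //= i IHi; rewrite addNb -IHi.
by have := bip_e (es (iter i s x)); case: (c _); case: (c _).
Qed.

Lemma iter_neq i x : 0 < i < 6 -> iter i s x != x.
Proof.
move=> i6; have [oi|] := boolP (odd i).
  apply/eqP=> E; have := color_iter i x; rewrite E oi.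
  by case: (c x).
by case: i i6 => [|[|[|[|[|[|]]]]]] //= _ _; case: (s24_neq x).
Qed.

Lemma order_ge6 x : 6 <= order s x.
Proof.
rewrite leqNgt; apply/negP=> lt6; have := iter_neq x (i := order s x).
by rewrite iter_order // eqxx lt6 order_gt0 => /(_ isT).
Qed.

Lemma order_even x : odd (order s x) = false.
Proof. by have := color_iter (order s x) x; rewrite iter_order //; case: odd; case: (c x). Qed.

Lemma not_e_color x y : c x = c y -> e x y = false.
Proof. by move=> cE; apply/negP=> /bip_e; rewrite cE eqxx. Qed.

Lemma uniq_traject k x : k <= order s x -> uniq (traject s x k).
Proof.
move=> kl; have := orbit_uniq s x.
by rewrite /orbit -(subnKC kl) trajectD cat_uniq => /andP[].
Qed.

(** The two ends have the same colour, so they are not adjacent. *)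
Lemma good_piece3 x : good_piece (traject s x 3).
Proof.
split=> // [|x0 i j]; first by apply: uniq_traject; apply: leq_trans (order_ge6 x).
have exx y : e y y = false by apply: not_e_color.
have e2 : e x (s (s x)) = false by apply/not_e_color/esym; apply: (color_iter 2).
have es' y : e (s y) y by rewrite sym_e.
by case: i => [|[|[|]]] //; case: j => [|[|[|]]] //= _ _; rewrite ?exx ?es ?es' ?e2 // sym_e.
Qed.

(** The ends could otherwise be adjacent only along the cycle, whose length would then be 2 or 4. *)
Lemma good_piece4 x : m x != iter 3 s x -> good_piece (traject s x 4).
Proof.
move=> gx; split=> // [|x0 i j]; first by apply: uniq_traject; apply: leq_trans (order_ge6 x).
have exx y : e y y = false by apply: not_e_color.
have e2 y : e y (s (s y)) = false by apply/not_e_color/esym; apply: (color_iter 2).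
have es' y : e (s y) y by rewrite sym_e.
have e3 : e x (s (s (s x))) = false.
  apply/negP=> /e_ms; rewrite eq_sym (negPf gx) /= (negPf (iter_neq (i := 4) x isT)) orbF.
  by rewrite (inj_eq s_inj); have := iter_neq (i := 2) x isT => /= /negPf->.
by case: i => [|[|[|[|]]]] //; case: j => [|[|[|[|]]]] //= _ _;
  rewrite ?exx ?es ?es' ?e2 ?e3 // sym_e ?e2 ?e3.
Qed.

Definition pieces (t : seq T) :=
  exists2 ss, flatten ss = t & forall u, u \in ss -> good_piece u.

Lemma pieces_cat t1 t2 : good_piece t1 -> pieces t2 -> pieces (t1 ++ t2).
Proof.
move=> g1 [ss <- gss]; exists (t1 :: ss) => // u.
by rewrite inE => /predU1P[->|/gss].
Qed.

Lemma pieces_thirds q x : pieces (traject s x (3 * q)).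
Proof.
elim: q x => [|q IHq] x; first by exists [::].
rewrite mulnS trajectD; apply: pieces_cat => //; exact: good_piece3.
Qed.

Lemma order_connect x y : fconnect s x y -> order s y = order s x.
Proof.
by move=> xy; apply/esym/eq_card; apply: same_connect xy; apply: fconnect_sym.
Qed.

(** The vertex [z] starts two consecutive segments of order 4 with no chord between their ends. Call
    a vertex bad if its chord leads three steps ahead. If [z] and [iter 3 s z] were both bad, the
    only chord at the latter would lead both back to [z] and on to [iter 6 s z], which differs from
    [z] on a cycle longer than 6. Without a good cut all vertices of the cycle would be bad. *)
Lemma exists_good_cut x : 6 < order s x -> exists z, [/\ fconnect s x z,
  m z != iter 3 s z & m (iter 4 s z) != iter 7 s z].
Proof.
move=> l6; pose bad z := m z == iter 3 s z.
have badA z : fconnect s x z -> bad z -> ~~ bad (iter 3 s z).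
  move=> xz /eqP bz; apply/negP=> /eqP; rewrite -bz mK bz -iterD => z6.
  have := findex_iter (f := s) (x := z) (i := 6); rewrite (order_connect xz) => /(_ l6).
  by rewrite -z6 findex0.
have [/existsP[z /and3P[]]|none] :=
  boolP [exists z, [&& fconnect s x z, ~~ bad z & ~~ bad (iter 4 s z)]].
  by exists z.
have badB z : fconnect s x z -> ~~ bad z -> bad (iter 4 s z).
  move=> xz gz; apply: contraNT none => gz4; apply/existsP; exists z.
  by rewrite xz gz.
(* If no cut exists, badness propagates from y = s^3 z to s y: z is good, hence
   s^4 z is bad. *)
have step y : fconnect s x y -> bad y -> bad (s y).
  move=> xy bady; pose z := iter 3 (finv s) y.
  have yE : iter 3 s z = y by rewrite /z /= !f_finv.
  have xz : fconnect s x z.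
    apply: connect_trans xy _; rewrite fconnect_sym // -yE; exact: fconnect_iter.
  rewrite -yE -iterS; apply: badB => //.
  by apply/negP=> /(badA _ xz); rewrite yE bady.
have [y xy bady] : exists2 y, fconnect s x y & bad y.
  have [bx|/(badB _ (connect0 _ x)) bx] := boolP (bad x); first by exists x.
  by exists (iter 4 s x) => //; apply: fconnect_iter.
have bad_iter i : bad (iter i s y).
  elim: i => //= i; apply: step; apply: connect_trans xy _; exact: fconnect_iter.
by have := badA y xy bady; rewrite bad_iter.
Qed.

Lemma orbit_pieces x : exists2 z, fconnect s x z & pieces (orbit s z).
Proof.
have lx := order_ge6 x; have ox := order_even x.
have dvd_pieces : 3 %| order s x -> pieces (orbit s x).
  by rewrite /orbit => /dvdnP[q ->]; rewrite mulnC; apply: pieces_thirds.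
have [/dvd_pieces|n3] := boolP (3 %| order s x); first by exists x; rewrite ?connect0.
have l6 : 6 < order s x by rewrite ltn_neqAle lx andbT; apply: contraNneq n3 => <-.
have [z [xz g0 g4]] := exists_good_cut l6; exists z => //.
have lz := order_connect xz; rewrite -lz in ox n3 l6.
(* The quotient by 3 is at least 2 because the length exceeds 6, so neither [.-1] nor [.-2]
   truncates. *)
rewrite /orbit; have [r1|r2] : order s z %% 3 = 1 \/ order s z %% 3 = 2 by lia.
  have -> : order s z = 4 + 3 * (order s z %/ 3).-1 by lia.
  by rewrite trajectD; apply: pieces_cat; [apply: good_piece4 | apply: pieces_thirds].
have -> : order s z = 4 + (4 + 3 * (order s z %/ 3).-2) by lia.
rewrite trajectD; apply: pieces_cat; first exact: good_piece4.
rewrite trajectD; apply: pieces_cat; last exact: pieces_thirds.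
by apply: good_piece4; rewrite -iterD.
Qed.

(** One cycle is removed at a time; what remains is again closed under [s] because [s] is injective.
    The case of interest is the whole vertex set. *)
Lemma closed_set_pieces (D : {set T}) : (forall x, x \in D -> s x \in D) ->
  exists ss, [/\ uniq (flatten ss), flatten ss =i D &
    forall u, u \in ss -> good_piece u].
Proof.
have [n] := ubnP #|D|; elim: n D => // n IHn D /ltnSE leDn sD.
have [->|[x xD]] := set_0Vmem D; first by exists [::]; split=> // x; rewrite inE.
have [z xz [ss ssE gss]] := orbit_pieces x.
have itD y i : y \in D -> iter i s y \in D by move=> yD; elim: i => //= i; apply: sD.
have conD y w : y \in D -> fconnect s y w -> w \in D.
  by move=> yD /iter_findex <-; apply: itD.
have zD := conD _ _ xD xz.
pose D' := [set y in D | ~~ fconnect s z y].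
have [||ss' [us' ssE' gss']] := IHn D'.
- apply: leq_trans leDn; apply/proper_card/properP; split.
    by apply/subsetP=> y; rewrite inE => /andP[].
  by exists z; rewrite // inE zD connect0.
- move=> y; rewrite !inE => /andP[yD nzy]; rewrite sD //=.
  by rewrite (same_fconnect1_r s_inj) in nzy.
exists (ss ++ ss'); rewrite flatten_cat ssE; split=> [|y|u].
- rewrite cat_uniq orbit_uniq us' andbT; apply/hasPn=> y.
  by rewrite ssE' inE -fconnect_orbit => /andP[].
- rewrite mem_cat ssE' -fconnect_orbit inE; have [zy|] := boolP (fconnect s z y).
    by rewrite (conD _ _ zD zy).
  by rewrite andbT.
- by rewrite mem_cat => /orP[/gss|/gss'].
Qed.

End CyclePartition.

(** * Assembling the partition *)

Lemma uniq_flatten_eq (T : eqType) (ss : seq (seq T)) t u x : uniq (flatten ss) ->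
  t \in ss -> u \in ss -> x \in t -> x \in u -> t = u.
Proof.
elim: ss => //= v ss IHss; rewrite cat_uniq => /and3P[_ /hasPn dis uss].
have out w : w \in ss -> x \in w -> x \notin v.
  by move=> wss xw; apply/dis/flattenP; exists w.
rewrite !inE => /predU1P[->|tss] /predU1P[->|us'] xt xu //.
- by rewrite (negPf (out _ us' xu)) in xt.
- by rewrite (negPf (out _ tss xt)) in xu.
- exact: IHss.
Qed.

Theorem mainTheorem4 (T : finType) (e : rel T) :
  simple_graph e -> cubic e -> connected e -> bipartite e ->
  (exists P : {set {set T}}, IPD e P) /\
  (exists P : {set {set T}}, IPD e P /\ 3 * #|P| <= #|T|).
Proof.
move=> [sym_e _] cubic_e _ [c bip_e].
suff [P [IPDP leP]] : exists P : {set {set T}}, IPD e P /\ 3 * #|P| <= #|T|.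
  by split; exists P.
have [m [s [mK s_inj es e_ms s24_neq]]] := square_free_two_factor sym_e cubic_e bip_e.
have [//|ss [uss ssE gss]] :=
  closed_set_pieces sym_e bip_e mK s_inj es e_ms s24_neq (D := setT).
pose P := [set S in [seq [set x in t] | t <- ss]].
have PP S : S \in P -> exists2 t, t \in ss & S = [set x in t].
  by rewrite inE => /mapP[t tss ->]; exists t.
have partP : partition P [set: T].
  apply/and3P; split.
  - apply/eqP/setP=> x; rewrite inE; apply/bigcupP.
    have := ssE x; rewrite inE => /flattenP[t tss xt].
    by exists [set y in t]; rewrite inE //; apply/mapP; exists t.
  - apply/trivIsetP=> A B /PP[t tss ->] /PP[u uin ->]; apply: contraR.
    case/pred0Pn=> x /andP[]; rewrite !inE => xt xu.
    by rewrite (uniq_flatten_eq uss tss uin xt xu).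
  - apply/negP=> /PP[t /gss[_]]; case: t => // x t _ _ /setP/(_ x).
    by rewrite !inE eqxx.
exists P; split.
  split=> // S /PP[t /gss[ut st et] SE].
  by exists t; split=> //; apply: ltnW.
(* The orders of the parts sum to the order of the graph, and each is at least 3. *)
rewrite -cardsT (card_partition partP) mulnC -sum_nat_const; apply: leq_sum => S.
by case/PP=> t /gss[ut st _] ->; rewrite cardsE (card_uniqP ut).
Qed.
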